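(* Let $L/K$ be a finite field extension over a field $K$ of arbitrary characteristic. Then the following statements are equivalent: 1. $\mathcal{D}(L/K)=L$. 2. $\mathrm{Der}(L/K)=0$. 3. $\Omega_{L/K}=0$. 4. $L/K$ is a separable field extension (equivalently, either $\mathrm{char}(K)=0$, or $\mathrm{char}(K)=p>0$ and $L=L^{sep}L^p$). 5. $L_{dif}=L$. 6. The algebra $\mathcal{D}(L/K)$ is a commutative algebra.
   Context: For a finite field extension $L/K$: $\mathcal{D}(L/K)=\bigcup_{i\ge0}\mathcal{D}_i\subseteq\mathrm{End}_K(L)$ is the algebra of $K$-linear differential operators on $L$, where $\mathcal{D}_0=L$ (acting by multiplication) and $\mathcal{D}_i=\{\delta\in\mathrm{End}_K(L)\mid\delta l-l\delta\in\mathcal{D}_{i-1}\text{ for all }l\in L\}$. $\mathrm{Der}(L/K)$ is the set of $K$-derivations of $L$, $\Omega_{L/K}$ is the module of Kähler differentials. $L_{dif}=\{l\in L\mid l\delta=\delta l\text{ for all }\delta\in\mathcal{D}(L/K)\}$. $L^{sep}$ is the largest separable subfield of $L/K$; in characteristic $p$, $L^p=\{l^p\mid l\in L\}$ and $L^{sep}L^p$ is the subfield of $L$ generated by $L^{sep}$ and $L^p$. *)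

(* Defs.v *)
From HB Require Import structures.
From mathcomp Require Import all_boot all_algebra all_field.
From mathcomp Require Import ring_quotient.
From mathcomp Require Import boolp classical_sets.
From mathcomp.multinomials Require Import freeg.

Set Implicit Arguments.
Unset Strict Implicit.
Unset Printing Implicit Defensive.
Import GRing.Theory.
Local Open Scope ring_scope.
Local Open Scope classical_set_scope.
Local Open Scope quotient_scope.

Section DifferentialOperators.
Variables (K : fieldType) (L : fieldExtType K).

(* [amull l] is the multiplication v |-> l * v; it embeds L into End_K(L).
   Composition is written with \o because the ring product that MathComp puts
   on 'End(L) is the reversed one. *)
Definition mulops : set 'End(L) := range (@amull K L).

Fixpoint diffops_le (i : nat) : set 'End(L) :=
  if i is j.+1 then
    [set delta | forall l : L,
       diffops_le j ((delta \o amull l)%VF - (amull l \o delta)%VF)]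
  else mulops.

Definition diffops : set 'End(L) := \bigcup_i diffops_le i.

Definition Ldif : set L :=
  [set l | forall delta, diffops delta ->
     (amull l \o delta)%VF = (delta \o amull l)%VF].

(* [Derivation fullv D] is the Leibniz rule on the whole of L. *)
Definition derivations : set 'End(L) := [set D | Derivation fullv D].

End DifferentialOperators.

Arguments mulops {K} L.
Arguments diffops_le {K} L i.
Arguments diffops {K} L.
Arguments Ldif {K} L.
Arguments derivations {K} L.

Section SeparablePart.
Variables (K : fieldType) (L : fieldExtType K).

(* Subfields of L that need not contain K. *)
Definition is_subfield (A : set L) : Prop := divring_closed [in A].

Definition subfield_gen (A : set L) : set L := smallest is_subfield A.

(* The union of the intermediate fields separable over K; [Lsep_largest]
   shows that it is one of them. *)
Definition Lsep : set L :=
  \bigcup_(E in [set E : {subfield L} | separable 1 E]) [set` E].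

Definition Lpow (p : nat) : set L := range (fun l : L => l ^+ p).

Lemma Lsep_largest : exists E : {subfield L},
  [/\ separable 1 E, Lsep = [set` E]
    & forall F : {subfield L}, separable 1 F -> (F <= E)%VS].
Proof.
pose x := separable_generator 1 (fullv : {vspace L}).
have maxE (F : {subfield L}) : separable 1 F -> (F <= <<1%AS; x>>)%VS.
  move=> /separableP sF; apply/subvP => y /sF sy.
  rewrite -separable_inseparable_element; apply/andP; split.
    exact: separable_elementS (subv_adjoin _ _) sy.
  exact: (purely_inseparableP (separable_generator_maximal _ _) _ (memvf y)).
have sE : separable 1 <<1%AS; x>>.
  by rewrite -adjoin_separable_eq separable_generatorP.
exists <<1; x>>%AS; split=> //.
apply/seteqP; split=> [y [F /= sF yF]|y /= yE]; first exact: (subvP (maxE F sF)).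
by exists <<1; x>>%AS.
Qed.

End SeparablePart.

Arguments Lsep {K} L.
Arguments Lpow {K} L p.

(* Omega_{L/K}: the free L-module on symbols [d a], a in L, modulo the
   submodule generated by additivity, the Leibniz rule and d(K) = 0. *)
Section Kaehler.
Variables (K : fieldType) (L : fieldExtType K).

Local Notation free := {freeg L / L}.
Local Notation gen a := ([freeg [:: (1, a)]] : free).

Inductive kaehler_rel : free -> Prop :=
| KaehlerAdd a b : kaehler_rel (gen (a + b) - gen a - gen b)
| KaehlerMul a b : kaehler_rel (gen (a * b) - a *: gen b - b *: gen a)
| KaehlerCst (k : K) : kaehler_rel (gen k%:A).

Definition kaehler_null : {pred free} :=
  fun w => `[< smallest (fun S => submod_closed [in S]) kaehler_rel w >].

Lemma kaehler_null_closed : submod_closed kaehler_null.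
Proof.
split=> [|c u v /asboolP uN /asboolP vN]; apply/asboolP => S [sS relS].
  by have := sS.1; rewrite inE.
have uS := uN _ (conj sS relS); have vS := vN _ (conj sS relS).
by have := sS.2 c u v; rewrite !inE; apply.
Qed.

HB.instance Definition _ :=
  GRing.isSubmodClosed.Build L free kaehler_null kaehler_null_closed.

Lemma kaehler_rel_null w : kaehler_rel w -> w \in kaehler_null.
Proof. by move=> rw; apply/asboolP => S [_]; apply. Qed.

Definition kaehler : Type := Quotient.quot kaehler_null.
HB.instance Definition _ := GRing.Zmodule.on kaehler.
HB.instance Definition _ := EqQuotient.on kaehler.

Lemma kaehler_eq (u v : free) :
  (\pi_kaehler u == \pi_kaehler v) = (u - v \in kaehler_null).
Proof. by rewrite (Quotient.idealrBE kaehler_null). Qed.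

Lemma kaehler_piD : {morph \pi_kaehler : u v / u + v}.
Proof. exact: (@raddfD free kaehler \pi_kaehler). Qed.

Lemma kaehler_pi0 : \pi_kaehler 0 = 0.
Proof. exact: (@raddf0 free kaehler \pi_kaehler). Qed.

Definition kaehler_scale (c : L) (w : kaehler) : kaehler :=
  \pi_kaehler (c *: repr w).

Lemma kaehler_piZ c (u : free) :
  \pi_kaehler (c *: u) = kaehler_scale c (\pi_kaehler u).
Proof.
apply/eqP; rewrite kaehler_eq -scalerBr rpredZ // -kaehler_eq.
by rewrite reprK.
Qed.

Lemma kaehler_scaleA a b w :
  kaehler_scale a (kaehler_scale b w) = kaehler_scale (a * b) w.
Proof. by rewrite -[w]reprK -(kaehler_piZ b) -!kaehler_piZ scalerA. Qed.

Lemma kaehler_scale1 : left_id 1 kaehler_scale.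
Proof. by move=> w; rewrite -[w]reprK -kaehler_piZ scale1r. Qed.

Lemma kaehler_scaleDr : right_distributive kaehler_scale +%R.
Proof.
move=> c v w; rewrite -[v]reprK -[w]reprK -kaehler_piD -!kaehler_piZ.
by rewrite scalerDr kaehler_piD.
Qed.

Lemma kaehler_scaleDl w : {morph kaehler_scale^~ w : a b / a + b}.
Proof.
by move=> a b; rewrite -[w]reprK -!kaehler_piZ scalerDl kaehler_piD.
Qed.

HB.instance Definition _ := GRing.Zmodule_isLmodule.Build L kaehler
  kaehler_scaleA kaehler_scale1 kaehler_scaleDr kaehler_scaleDl.

Definition kaehler_d (a : L) : kaehler := \pi_kaehler (gen a).

Lemma kaehler_dD a b : kaehler_d (a + b) = kaehler_d a + kaehler_d b.
Proof.
rewrite -kaehler_piD; apply/eqP; rewrite kaehler_eq opprD addrA.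
exact/kaehler_rel_null/KaehlerAdd.
Qed.

Lemma kaehler_dM a b :
  kaehler_d (a * b) = a *: kaehler_d b + b *: kaehler_d a.
Proof.
rewrite /GRing.scale /= -!kaehler_piZ -kaehler_piD; apply/eqP.
rewrite kaehler_eq opprD addrA; exact/kaehler_rel_null/KaehlerMul.
Qed.

Lemma kaehler_dC (k : K) : kaehler_d k%:A = 0.
Proof.
rewrite -kaehler_pi0; apply/eqP; rewrite kaehler_eq subr0; exact/kaehler_rel_null/KaehlerCst.
Qed.

End Kaehler.

Section KaehlerUniversal.
Variables (K : fieldType) (L : fieldExtType K).
Local Notation Omega := (kaehler L).
Local Notation d := (@kaehler_d K L).

Lemma kaehler_ind (P : Omega -> Prop) :
    P 0 -> (forall c a w, P w -> P (c *: d a + w)) -> forall w, P w.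
Proof.
move=> P0 PD w; rewrite -[w]reprK -[repr w]freeg_sumE.
elim: (dom _) => [|a s IHs]; first by rewrite big_nil kaehler_pi0.
rewrite big_cons kaehler_piD.
have -> : [freeg [:: (coeff a (repr w), a)]] =
          coeff a (repr w) *: ([freeg [:: (1, a)]] : {freeg L / L}).
  by apply/eqP/freeg_eqP => z; rewrite coeffZ !coeffU mul1r.
by rewrite kaehler_piZ; apply: PD.
Qed.

Lemma kaehler_universal (M : lmodType L) (D : L -> M) :
    (forall a b, D (a + b) = D a + D b) ->
    (forall a b, D (a * b) = a *: D b + b *: D a) ->
    (forall k : K, D k%:A = 0) ->
  exists2 f : {linear Omega -> M}, (forall a, f (d a) = D a)
    & forall g : {linear Omega -> M}, (forall a, g (d a) = D a) -> g =1 f.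
Proof.
move=> DD DM DC; pose F : {freeg L / L} -> M := fglift D.
have Fgen a : F [freeg [:: (1, a)]] = D a by rewrite /F liftU scale1r.
have FB : {morph F : u v / u - v} := lift_is_additive D.
have F0 : F 0 = 0 by rewrite -(subrr 0) FB subrr.
have FD : {morph F : u v / u + v}.
  by move=> u v; rewrite -[v in LHS]opprK -(sub0r v) !FB F0 sub0r opprK.
have FU c a : F [freeg [:: (c, a)]] = c *: D a by rewrite /F liftU.
have FZ c u : F (c *: u) = c *: F u.
  rewrite -[u]freeg_sumE scaler_sumr.
  elim: (dom u) => [|a s IHs]; first by rewrite !big_nil F0 scaler0.
  rewrite !big_cons !FD scalerDr IHs !FU; congr (_ + _).
  have -> : c *: [freeg [:: (coeff a u, a)]] = [freeg [:: (c * coeff a u, a)]].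
    by apply/eqP/freeg_eqP => z; rewrite coeffZ !coeffU mulrA.
  by rewrite FU scalerA.
have Fnull u : u \in @kaehler_null K L -> F u = 0.
  move=> /asboolP uN; apply: (uN [set v | F v = 0]); split=> [|v [a b|a b|k]] /=.
  - split=> [|c v w]; first by apply/mem_set.
    move=> /set_mem /= v0 /set_mem /= w0; apply/mem_set.
    by rewrite /= FD FZ v0 w0 scaler0 addr0.
  - by rewrite !FB !Fgen DD addrAC addrK subrr.
  - by rewrite !FB !FZ !Fgen DM addrAC addrK subrr.
  - by rewrite Fgen DC.
pose f (w : Omega) : M := F (repr w).
have fpi u : f (\pi_Omega u) = F u.
  apply/eqP; rewrite -subr_eq0 -FB Fnull // -kaehler_eq.
  by rewrite reprK.
have flin : linear f.
  move=> c v w; rewrite -[v]reprK -[w]reprK /GRing.scale /=.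
  by rewrite -kaehler_piZ -kaehler_piD !fpi FD FZ.
pose fl := GRing.isLinear.Build L Omega M _ f flin.
pose fL : {linear Omega -> M} := HB.pack f fl.
exists fL => [a|g gd w]; first by rewrite /= fpi Fgen.
elim/kaehler_ind: w => [|c a w IHw]; first by rewrite !raddf0.
rewrite !linearP IHw gd; congr (_ *: _ + _).
by rewrite /= fpi Fgen.
Qed.

End KaehlerUniversal.

(* Main.v *)
Require Import Defs.
From mathcomp Require Import all_boot all_algebra all_field.
From mathcomp Require Import boolp classical_sets.
From mathcomp Require Import ring.

Import GRing.Theory.
Local Open Scope ring_scope.
Local Open Scope classical_set_scope.

(** Everything is compared with the vanishing of Der(L/K).
    If [delta] commutes with multiplications up to elements of L, then
    [delta - delta 1] is a derivation; so Der(L/K) = 0 forces D_1 = L, and then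
    D_i = L by induction. A derivation kills separable elements (apply it to
    the minimal polynomial; the same computation works in Omega) and, in
    characteristic p, p-th powers. Conversely, if L/K is not separable, pick a
    maximal proper subfield E over which L is purely inseparable: then L = E(x)
    with x inseparable over E, and such a simple extension has a nonzero
    E-derivation. *)

Section DiffOps.
Context {K : fieldType} {L : fieldExtType K}.
Implicit Types (l x y : L) (delta D : 'End(L)).

Lemma amullE l x : amull l x = l * x.
Proof. by rewrite lfunE. Qed.

Lemma derivationsP D :
  derivations L D <-> (forall x y, D (x * y) = D x * y + x * D y).
Proof.
split=> [derD x y|derD]; last by apply/allrelP => x y _ _; rewrite derD.
by rewrite (Derivation_mul derD) ?memvf.
Qed.

Lemma derivations_eq0 :
    (forall D, derivations L D -> forall x, D x = 0) ->
  derivations L = [set 0].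
Proof.
move=> der0; apply/seteqP; split=> [D derD|_ ->] /=; last first.
  by apply/derivationsP => x y; rewrite !lfunE mulr0 mul0r addr0.
by apply/lfunP => x; rewrite lfunE /= der0.
Qed.

Lemma derivation1 D : derivations L D -> D 1 = 0.
Proof. exact: Derivation1. Qed.

Lemma derivation_scalar D (k : K) : derivations L D -> D k%:A = 0.
Proof. by move/derivation1 => D1; rewrite linearZ /= D1 scaler0. Qed.

Lemma derivationsV D x : derivations L D -> D x = 0 -> D x^-1 = 0.
Proof.
move=> derD Dx; have [->|x0] := eqVneq x 0; first by rewrite invr0 linear0.
have := derivation1 _ derD; rewrite -(divff x0) (derivationsP D).1 // Dx.
by rewrite mul0r add0r => /eqP; rewrite mulf_eq0 (negPf x0) => /eqP.
Qed.

(** [D] restricts to a derivation of K(x) that kills K, and separability of [x] forces every such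
    derivation to vanish on K(x). *)
Lemma derivation_separable_element D x :
  derivations L D -> separable_element 1 x -> D x = 0.
Proof.
move=> derD /Derivation_separableP sepx; apply/eqP; rewrite -memv_ker.
apply: (subvP (sepx D _ _)); last exact: memv_adjoin.
  exact: DerivationS (subvf _) derD.
by apply/subvP => y y1; rewrite memv_ker (Derivation_scalar derD).
Qed.

Lemma mulops_diffops l : diffops L (amull l).
Proof. by exists 0%N => //; exists l. Qed.

Lemma diffops_le1P delta :
  diffops_le L 1 delta <-> derivations L (delta - amull (delta 1)).
Proof.
rewrite derivationsP; split=> [d1 x y|derD l].
  have [a _ aE] := d1 x.
  have E z : a * z = delta (x * z) - x * delta z.
    by rewrite -[a * z]amullE aE !(add_lfunE, opp_lfunE, comp_lfunE, amullE).
  (* At 1 this gives [a = delta x - x * delta 1]; substituting it at [y] yields the Leibniz rule. *)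
  have := E 1; have := E y; rewrite !mulr1 => Ey Ea.
  rewrite !(add_lfunE, opp_lfunE, comp_lfunE, amullE).
  by rewrite -[delta (x * y)](subrK (x * delta y)) -Ey Ea; ring.
(* The witness is the value at [l] of the derivation [delta - amull (delta 1)]. *)
exists (delta l - delta 1 * l) => //; apply/lfunP => x.
have := derD l x; rewrite !(add_lfunE, opp_lfunE, comp_lfunE, amullE) => e.
by rewrite -[delta (l * x)](subrK (delta 1 * (l * x))) e; ring.
Qed.

(** L is its own centralizer in End_K(L): an operator commuting with all multiplications is
    determined by its value at 1. *)
Lemma mulopsP delta :
  mulops L delta <-> (forall l, (delta \o amull l)%VF = (amull l \o delta)%VF).
Proof.
split=> [[a _ <-] l|comm].
  by apply/lfunP => x; rewrite !comp_lfunE !amullE mulrCA.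
exists (delta 1) => //; apply/lfunP => x.
have := congr1 (fun f : 'End(L) => f 1) (comm x).
by rewrite !comp_lfunE !amullE mulr1 mulrC.
Qed.

Lemma derivations0_diffops :
  derivations L = [set 0] -> diffops L = mulops L.
Proof.
move=> der0; have le1 delta : diffops_le L 1 delta -> mulops L delta.
  move=> /diffops_le1P; rewrite der0 => /= /eqP; rewrite subr_eq0 => /eqP ->.
  by exists (delta 1).
apply/seteqP; split=> [delta [i _]|delta]; last by exists 0%N.
(* By induction the commutators of [delta] with multiplications lie in L, which puts [delta] in
   D_1. *)
elim: i delta => // i IHi delta dS; apply: le1 => l; exact: IHi (dS l).
Qed.

Lemma derivation_diffops D : derivations L D -> diffops L D.
Proof.
move=> derD; exists 1%N => //; apply/diffops_le1P.
by rewrite (derivation1 _ derD) linear0 subr0.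
Qed.

(** A derivation vanishes at 1, and a multiplication vanishing at 1 is zero. *)
Lemma diffops_mulops_derivations0 :
  diffops L = mulops L -> derivations L = [set 0].
Proof.
move=> dL; apply: derivations_eq0 => D derD x.
have := derivation_diffops _ derD; rewrite dL => -[a _ Da].
by have := derivation1 _ derD; rewrite -Da !amullE mulr1 => ->; rewrite mul0r.
Qed.

End DiffOps.

Section Separability.
Context {K : fieldType} {L : fieldExtType K}.

(** Induction on the codimension of [E], which is enlarged to E(x) as long as E(x) is not all of
    L. *)
Lemma exists_derivation_purely_inseparable (E : {subfield L}) :
    purely_inseparable E (fullv : {vspace L}) -> E != fullv :> {vspace L} ->
  exists2 D : 'End(L), derivations L D & D != 0.
Proof.
have [n] := ubnP (\dim (fullv : {vspace L}) - \dim E).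
elim: n E => // n IHn E leEn insepE neE.
have /subvPn[x _ xE] : ~~ (fullv <= E)%VS.
  by apply: contra neE => sLE; rewrite eqEsubv subvf.
have sEx := subv_adjoin E x.
have [Ex|neEx] := eqVneq (<<E; x>>%VS) (fullv : {vspace L}); last first.
  apply: (IHn <<E; x>>%AS) => //; last first.
    apply/purely_inseparableP => y yL; apply: sub_inseparable sEx _.
    exact: (purely_inseparableP insepE).
  have ltd : (\dim E < \dim <<E; x>>)%N.
    rewrite ltn_neqAle dimvS // andbT; apply: contraNneq xE => dE.
    have /eqP -> : E == <<E; x>>%VS :> {vspace L} by rewrite eqEdim sEx dE leqnn.
    exact: memv_adjoin.
  have := dimvS (subvf <<E; x>>%VS) => le2.
  by move: leEn; rewrite ltnS; apply: leq_trans; apply: ltn_sub2l => //;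
    apply: leq_trans le2.
(* An element both separable and purely inseparable over [E] would lie in [E]. *)
have /Derivation_separableP nsep : ~~ separable_element E x.
  apply: contra xE => sepx; rewrite -separable_inseparable_element sepx.
  exact: (purely_inseparableP insepE) (memvf x).
have [D [derD DE DN]] : exists D, [/\ Derivation <<E; x>> D, (E <= lker D)%VS
                             & ~~ (<<E; x>> <= lker D)%VS].
  apply: contrapT => noD; apply: nsep => D derD DE.
  by apply: contrapT => /negP DN; apply: noD; exists D.
rewrite Ex in derD DN; exists D => //.
by apply: contraNneq DN => ->; apply/subvP => y _; rewrite memv_ker lfunE.
Qed.

Lemma derivations0_separable :
  derivations L = [set 0] -> separable 1 (fullv : {vspace L}).
Proof.
move=> der0; apply: contrapT => /negP nsep.
(* [S] is the separable closure of K in L, and L is purely inseparable over it. *)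
pose S := <<1%AS; separable_generator 1 (fullv : {vspace L})>>%AS.
have neS : S != fullv :> {vspace L}.
  apply: contraNneq nsep => <-.
  by rewrite -adjoin_separable_eq separable_generatorP.
have [D] :=
  exists_derivation_purely_inseparable S (separable_generator_maximal _ _) neS.
by rewrite der0 => /= ->; rewrite eqxx.
Qed.

Lemma separable_derivations0 :
  separable 1 (fullv : {vspace L}) -> derivations L = [set 0].
Proof.
move=> /separableP sepL; apply: derivations_eq0 => D derD x.
exact: derivation_separable_element (sepL x (memvf x)).
Qed.

(** The kernel of a derivation is a subfield, so only the generators need checking. *)
Lemma subfield_gen_derivations0 (p : nat) : p \in [pchar K] ->
  [set: L] = subfield_gen (Lsep L `|` Lpow L p) -> derivations L = [set 0].
Proof.
move=> charp genL; apply: derivations_eq0 => D derD x.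
have derM := (derivationsP D).1 derD.
suff kerD : subfield_gen (Lsep L `|` Lpow L p) `<=` [set y | D y = 0].
  by apply: kerD; rewrite -genL.
apply: smallest_sub.
  split=> [|y z|y z]; rewrite !inE /=; first exact: derivation1.
    by rewrite linearB /= => -> ->; rewrite subr0.
  by move=> Dy Dz; rewrite derM Dy (derivationsV _ _ derD Dz) mul0r mulr0 addr0.
move=> y [[E sepE yE]|[z _ <-]] /=.
  exact: derivation_separable_element derD (separableP sepE _ yE).
rewrite (Derivation_exp derD) ?memvf // -mulr_natr.
have -> : p%:R = 0 :> L.
  by rewrite -(rmorph_nat (in_alg L)) (pcharf0 charp) rmorph0.
by rewrite mulr0 mul0r.
Qed.

(** Chain rule in Omega: the coefficients of [q] come from K, so their differentials vanish. *)
Lemma kaehler_d_horner (q : {poly K}) (x : L) :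
  kaehler_d (map_poly (in_alg L) q).[x] =
  (map_poly (in_alg L) q)^`().[x] *: kaehler_d x.
Proof.
elim/poly_ind: q => [|q c IHq].
  by rewrite rmorph0 deriv0 !horner0 scale0r -(scale0r 1) kaehler_dC.
rewrite rmorphD rmorphM /= map_polyX map_polyC /= !derivE !hornerE.
rewrite kaehler_dD kaehler_dC addr0 kaehler_dM IHq.
by rewrite scalerA -scalerDl [x * _]mulrC.
Qed.

(** The differentials [kaehler_d x] span Omega. Differentiating m(x) = 0, for m the minimal
    polynomial, gives m'(x) dx = 0 with m'(x) nonzero by separability. *)
Lemma separable_kaehler0 :
  separable 1 (fullv : {vspace L}) -> forall w : kaehler L, w = 0.
Proof.
move=> /separableP sepL; elim/kaehler_ind => // c x w ->; rewrite addr0.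
have /polyOver1P[q mq] := minPolyOver 1 x.
have sepx := sepL x (memvf x); have := separable_root_der 1 x.
rewrite sepx /= => nr; have := kaehler_d_horner q x.
rewrite -mq minPolyxx -(scale0r 1) kaehler_dC => /esym.
move=> /(congr1 ( *:%R (minPoly 1 x)^`().[x]^-1)).
rewrite scalerA mulVf ?scale1r ?scaler0 => [->|]; first exact: scaler0.
by move: nr; rewrite rootE.
Qed.

Lemma kaehler0_derivations0 :
  (forall w : kaehler L, w = 0) -> derivations L = [set 0].
Proof.
move=> Om0; apply: derivations_eq0 => D derD x.
have derM := (derivationsP D).1 derD.
(* [D] factors through Omega; its target [L^o] is L as a module over itself. *)
have [|a b|k|f fd _] := @kaehler_universal _ L L^o D.
- exact: linearD.
- by rewrite derM addrC; congr (_ + _); rewrite mulrC.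
- exact: (derivation_scalar D k derD).
by rewrite -fd (Om0 (kaehler_d x)) linear0.
Qed.

End Separability.

Theorem proposition3p5 (K : fieldType) (L : fieldExtType K) :
  [<-> diffops L = mulops L;
       derivations L = [set 0];
       (forall w : kaehler L, w = 0);
       separable 1 (fullv : {vspace L});
       [pchar K] =i pred0 \/
         exists2 p : nat, p \in [pchar K] &
           [set: L] = subfield_gen (Lsep L `|` Lpow L p);
       Ldif L = [set: L];
       (forall delta epsilon : 'End(L), diffops L delta -> diffops L epsilon ->
          (delta \o epsilon)%VF = (epsilon \o delta)%VF)].
Proof.
tfae.
- exact: diffops_mulops_derivations0.
- by move/derivations0_separable/separable_kaehler0.
- by move/kaehler0_derivations0/derivations0_separable.
- move=> /separableP sepL.
  have [p0|] := pselect ([pchar K] =i pred0); first by left.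
  move=> /existsNP[p /eqP]; rewrite inE eqbF_neg negbK => charp.
  right; exists p => //; apply/seteqP; split=> // x _ A [_]; apply; left.
  (* L is itself a separable intermediate field, so [Lsep L] is already everything. *)
  by exists {:L}%AS; [exact/separableP|exact: memvf].
- move=> sep; suff /derivations0_diffops dL : derivations L = [set 0].
    apply/seteqP; split=> // l _ delta; rewrite dL => /mulopsP comm.
    exact/esym/comm.
  case: sep => [char0|[p]]; last exact: subfield_gen_derivations0.
  apply: separable_derivations0; apply/separableP => x _.
  by apply: pcharf0_separable => p; rewrite pchar_lalg char0.
- move=> LL delta epsilon /= ddelta depsilon.
  (* Every differential operator commutes with all multiplications, hence is one. *)
  have mul d : diffops L d -> mulops L d.
    move=> dd; apply/mulopsP => l; have : Ldif L l by rewrite LL.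
    by move/(_ d dd).
  have [a _ <-] := mul _ depsilon; exact: (mulopsP delta).1 (mul _ ddelta) a.
- move=> comm; apply/seteqP; split=> delta ddelta; last by exists 0%N.
  by apply/mulopsP => l; apply: comm => //; apply: mulops_diffops.
Qed.
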